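(* Let $\Gamma$ be a compact metric graph, let $d\ge 0$, and let $T\subseteq \mathrm{Div}^d_{+,\mathbb R}(\Gamma)$ be tropically convex and compact (with respect to the metric $\rho$). Then for every $E\in\mathrm{Div}^d_{+,\mathbb R}(\Gamma)$ there exists a unique $\mathbb R$-divisor $T_E\in T$ which minimizes the function $D\mapsto \mathfrak S(D-E)$ on $T$.
   Context: $\Gamma$ is a compact metric graph (finitely many edges, each of finite length). An $\mathbb R$-divisor on $\Gamma$ is a finite formal sum $D=\sum_p m_p\,(p)$ with $m_p\in\mathbb R$, $p\in\Gamma$; it is effective if all $m_p\ge0$, and its degree is $\sum_p m_p$. $\mathrm{Div}^d_{+,\mathbb R}(\Gamma)$ denotes the set of effective $\mathbb R$-divisors of degree $d$. For a continuous piecewise-linear function $f$ on $\Gamma$, its Laplacian is $\Delta f=\sum_p\sigma_p(f)\,(p)$, where $-\sigma_p(f)$ is the sum of the slopes of $f$ in all tangent directions emanating from $p$. For effective $D_1,D_2$ of the same degree there is a continuous piecewise-linear function $f_{D_2-D_1}$ with $\Delta f_{D_2-D_1}=D_2-D_1$, unique up to an additive constant. The distance is $\rho(D_1,D_2)=\max f_{D_2-D_1}-\min f_{D_2-D_1}$; it is a metric on $\mathrm{Div}^d_{+,\mathbb R}(\Gamma)$ and all topological notions refer to it. The tropical path from $D_1$ to $D_2$ is $P_{D_2-D_1}(t)=D_1+\Delta\min\big(t\rho(D_1,D_2),\,f_{D_2-D_1}-\min f_{D_2-D_1}\big)$, $t\in[0,1]$; its image is the tropical segment $\mathrm{tconv}(D_1,D_2)$.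 A set $T\subseteq\mathrm{Div}^d_{+,\mathbb R}(\Gamma)$ is tropically convex if $\mathrm{tconv}(D_1,D_2)\subseteq T$ for all $D_1,D_2\in T$. The $\mathfrak S$-function is $\mathfrak S(D_2-D_1)=\int_\Gamma\big(f_{D_2-D_1}-\min f_{D_2-D_1}\big)\,dx$, integration with respect to the length measure on $\Gamma$. *)

(* Defs.v *)
From HB Require Import structures.
From mathcomp Require Import all_boot all_order all_algebra.
From mathcomp Require Import all_classical all_reals all_analysis.

Set Implicit Arguments.
Unset Strict Implicit.
Unset Printing Implicit Defensive.

Import Order.TTheory GRing.Theory Num.Theory.
Import numFieldNormedType.Exports.

Local Open Scope classical_set_scope.
Local Open Scope ring_scope.

(* A compact metric graph, given by a model: finitely many vertices and edges,
   loops and parallel edges allowed. The orientation of an edge only serves to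
   parametrise it by [0, elen e]. *)
Record metric_graph (R : realType) := MetricGraph {
  vertex : finType;
  edge : finType;
  esrc : edge -> vertex;
  etgt : edge -> vertex;
  elen : edge -> R;
  elen_gt0 : forall e, 0 < elen e;
  vertex_gt0 : (0 < #|vertex|)%N;
  vertex_connected : forall u v,
    connect (fun x y : vertex =>
      [exists e, ((esrc e == x) && (etgt e == y))
              || ((esrc e == y) && (etgt e == x))]) u v
}.

Section MetricGraphTheory.
Variables (R : realType) (G : metric_graph R).
Local Notation edge := (edge G).

(* A point of Gamma is a vertex, or a point of the interior of an edge, at a
   given distance from the source of that edge. *)
Definition gpoint : Type :=
  (vertex G + {q : edge * R | 0 < q.2 < elen q.1})%type.

(* The parametrisation of the closed edge e by [0, elen e]; the values outside
   of [0, elen e] are irrelevant. *)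
Definition epoint (e : edge) (x : R) : gpoint :=
  if insub (e, x) is Some q then inr q
  else inl (if x <= 0 then esrc e else etgt e).

Definition affine_on (a b : R) (g : R -> R) :=
  exists c m : R, forall x, a <= x <= b -> g x = c + m * x.

(* g is affine on each closed interval of a subdivision a < s_0 < ... < b; such
   a g is continuous on [a, b]. *)
Definition piecewise_affine (a b : R) (g : R -> R) :=
  exists s : seq R,
    [/\ path <%R a s, last a s = b &
        forall i, (i < size s)%N -> affine_on (nth a (a :: s) i) (nth a s i) g].

(* Gamma is obtained by gluing the closed edges at the vertices, so f is
   continuous and piecewise linear iff it is so along each closed edge. *)
Definition PL (f : gpoint -> R) :=
  forall e : edge, piecewise_affine 0 (elen e) (f \o epoint e).

(* The slope of f at the point x of the edge e in the tangent direction s,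
   with s = 1 (towards the target) or s = -1 (towards the source). *)
Definition slope (f : gpoint -> R) (e : edge) (x s : R) : R :=
  lim ((f (epoint e (x + s * h)) - f (epoint e x)) / h @[h --> 0^'+]).

(* A loop at v contributes two tangent directions at v. *)
Definition sum_slopes (f : gpoint -> R) (p : gpoint) : R :=
  match p with
  | inl v => \sum_(e : edge | esrc e == v) slope f e 0 1
           + \sum_(e : edge | etgt e == v) slope f e (elen e) (-1)
  | inr q => slope f (val q).1 (val q).2 1 + slope f (val q).1 (val q).2 (-1)
  end.

Definition laplacian (f : gpoint -> R) : gpoint -> R :=
  fun p => - sum_slopes f p.

Definition is_divisor (D : gpoint -> R) := finite_set [set p | D p != 0].

Definition effective (D : gpoint -> R) := forall p, 0 <= D p.

Definition degree (D : gpoint -> R) : R := \sum_(p \in [set: gpoint]) D p.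

Record effdiv (d : R) := EffDiv {
  mult : gpoint -> R;
  effdiv_divisor : is_divisor mult;
  effdiv_effective : effective mult;
  effdiv_degree : degree mult = d
}.

(* f_D, for D a difference of effective divisors of the same degree: some
   solution of Delta f = D. It is determined up to an additive constant, on
   which nothing below depends. *)
Definition potential (D : gpoint -> R) : gpoint -> R :=
  xget (fun=> 0) [set f | PL f /\ laplacian f = D].

(* Both are attained when f is continuous, Gamma being compact. *)
Definition fmax (f : gpoint -> R) : R := sup (range f).
Definition fmin (f : gpoint -> R) : R := inf (range f).

(* The integral over Gamma against the length measure. *)
Definition gintegral (f : gpoint -> R) : R :=
  \sum_(e : edge) \int[lebesgue_measure]_(x in `[0, elen e]) f (epoint e x).

Definition Sfun (D : gpoint -> R) : R :=
  gintegral (fun p => potential D p - fmin (potential D)).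

Section FixedDegree.
Variable d : R.
Implicit Types D E : effdiv d.

Definition rho D1 D2 : R :=
  let f := potential (mult D2 \- mult D1) in fmax f - fmin f.

Definition tpath D1 D2 (t : R) : gpoint -> R :=
  let f := potential (mult D2 \- mult D1) in
  mult D1 \+ laplacian (fun p => Num.min (t * rho D1 D2) (f p - fmin f)).

Definition tconv D1 D2 : set (gpoint -> R) := tpath D1 D2 @` `[0, 1].

Definition tropically_convex (T : set (effdiv d)) :=
  forall D1 D2, T D1 -> T D2 -> tconv D1 D2 `<=` @mult d @` T.

Definition rho_open (U : set (effdiv d)) :=
  forall D, U D -> exists2 eps : R, 0 < eps & [set D' | rho D D' < eps] `<=` U.

Lemma rho_openT : rho_open setT.
Proof. by move=> D _; exists 1. Qed.

Lemma rho_openI : setI_closed rho_open.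
Proof.
move=> U V oU oV D [/oU[e e0 eU] /oV[e' e'0 e'V]].
exists (Num.min e e'); first by rewrite lt_min e0.
by move=> D' /=; rewrite lt_min => /andP[? ?]; split; [exact: eU|exact: e'V].
Qed.

Lemma rho_open_bigU (I : Type) (f : I -> set (effdiv d)) :
  (forall i, rho_open (f i)) -> rho_open (\bigcup_i f i).
Proof.
move=> of_ D [i _ /of_[e e0 ef]].
by exists e => // D' /ef fD'; exists i.
Qed.

End FixedDegree.
End MetricGraphTheory.

HB.instance Definition _ (R : realType) (G : metric_graph R) (d : R) :=
  gen_eqMixin (effdiv G d).
HB.instance Definition _ (R : realType) (G : metric_graph R) (d : R) :=
  gen_choiceMixin (effdiv G d).

(* The topology of Div^d_{+,R}(Gamma) is the one given by rho. *)
HB.instance Definition _ (R : realType) (G : metric_graph R) (d : R) :=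
  @isOpenTopological.Build (effdiv G d) (@rho_open R G d)
    (@rho_openT R G d) (@rho_openI R G d) (@rho_open_bigU R G d).

(* Main.v *)
From HB Require Import structures.
Require Import Defs.
From mathcomp Require Import all_boot all_order all_algebra.
From mathcomp Require Import all_classical all_reals all_analysis.
From mathcomp Require Import ring lra.
Import Order.TTheory GRing.Theory Num.Theory.
Import numFieldNormedType.Exports.
Local Open Scope classical_set_scope.
Local Open Scope ring_scope.

(** The Laplacian determines a piecewise linear function up to a constant, so
    [Sfun (D - E)] is the integral of the normalized potential of [D - E], the
    one with minimum 0.  Two such potentials, for [D] and [D'], differ by at most
    [rho D D'] everywhere; hence [Sfun] is continuous and attains its minimum
    on the compact set [T].

    For uniqueness, let [F1], [F2] be the normalized potentials of [D1 - E] and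
    [D2 - E], so that [F2 = F1 + g - m] with [g] the normalized potential of
    [D2 - D1].  Then [min (F1, F2) = F1 + min (m, g) - m] is the normalized
    potential of [D - E] for the point [D] of the tropical segment at height [m].
    If [D1] and [D2] both minimize, then [F1] and [F2] have an integral no larger
    than that of their pointwise minimum, so [F1 = F2] along the edges and
    [D1 = D2].

    Potentials exist: hat functions move the mass of a divisor to the vertices,
    where the weighted graph Laplacian is solved by linear algebra. *)

(** * One-sided affine germs and piecewise affine functions on an interval *)

Section RealFunctions.
Context {R : realType}.
Implicit Types (g k : R -> R) (a b x m s : R).

(* [g] is affine with slope [m] close to [x] in the direction [s] (1 or -1). *)
Definition germ g x s m := \forall h \near 0^'+, g (x + s * h) = g x + m * h.

Lemma germ_ex g x s m : germ g x s m -> exists2 e : R, 0 < e &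
  forall h, 0 <= h <= e -> g (x + s * h) = g x + m * h.
Proof.
move=> [e /= e0 ge]; exists (e / 2); first by rewrite divr_gt0.
move=> h /andP[]; rewrite le_eqVlt => /predU1P[<- _|h0 he].
  by rewrite !mulr0 !addr0.
apply: ge => //=; rewrite sub0r normrN gtr0_norm//; lra.
Qed.

Lemma ex_germ g x s m (e : R) : 0 < e ->
  (forall h, 0 <= h <= e -> g (x + s * h) = g x + m * h) -> germ g x s m.
Proof.
move=> e0 ge; rewrite /germ; near=> h.
by apply: ge; apply/andP; split => //; near: h; exact: nbhs_right_le.
Unshelve. all: end_near. Qed.

Lemma germ_lim {g x s m} : germ g x s m ->
  lim ((g (x + s * h) - g x) / h @[h --> 0^'+]) = m.
Proof.
move=> gm; apply: lim_near_cst => //; near=> h.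
have -> : g (x + s * h) = g x + m * h by near: h.
by rewrite [g x + _]addrC addrK mulfK// gt_eqF//; near: h; exact: nbhs_right_gt.
Unshelve. all: end_near. Qed.

Lemma germD g k x s m n : germ g x s m -> germ k x s n ->
  germ (fun y => g y + k y) x s (m + n).
Proof. by apply: filterS2 => h -> ->; ring. Qed.

Lemma germZ c g x s m : germ g x s m -> germ (fun y => c * g y) x s (c * m).
Proof. by apply: filterS => h ->; ring. Qed.

Lemma germ_cst c x s : germ (fun=> c) x s 0.
Proof. by apply: nearW => h; rewrite mul0r addr0. Qed.

Lemma germ_right a b g c m x : (forall y, a <= y <= b -> g y = c + m * y) ->
  a <= x < b -> germ g x 1 m.
Proof.
move=> gE xab; apply: (ex_germ _ _ _ _ (b - x)) => [|h he]; first lra.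
by rewrite !gE; [ring|lra|lra].
Qed.

Lemma germ_left a b g c m x : (forall y, a <= y <= b -> g y = c + m * y) ->
  a < x <= b -> germ g x (-1) (- m).
Proof.
move=> gE xab; apply: (ex_germ _ _ _ _ (x - a)) => [|h he]; first lra.
by rewrite !gE; [ring|lra|lra].
Qed.

Lemma germ_eq g k x s m (e : R) : 0 < e ->
  (forall h, 0 <= h <= e -> g (x + s * h) = k (x + s * h)) ->
  germ g x s m -> germ k x s m.
Proof.
move=> e0 gk /germ_ex[e' e'0 ge].
have ee' : 0 < Num.min e e' by rewrite lt_min e0.
apply: (ex_germ _ _ _ _ _ ee') => h /andP[h0]; rewrite le_min => /andP[he he'].
have := gk 0; rewrite mulr0 addr0 => <-; last by rewrite lexx ltW.
by rewrite -gk ?h0// ge ?h0.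
Qed.

Lemma near_lt_affine (u v m n : R) : u < v ->
  \forall h \near 0^'+, u + m * h <= v + n * h.
Proof.
(* [K] bounds [m - n]; the summand 1 keeps it positive, so [h] can be taken below [(v - u) / K]. *)
move=> uv; pose K := `|m| + `|n| + 1.
have K0 : 0 < K by rewrite ltr_wpDl// addr_ge0.
near=> h.
have h0 : 0 < h by [].
have hK : K * h <= v - u.
  rewrite mulrC -ler_pdivlMr//; near: h; apply: nbhs_right_le.
  by rewrite divr_gt0 ?subr_gt0.
have := ler_norm m; have := ler_norm (- n); rewrite normrN => nn mm.
have : (m - n) * h <= K * h by rewrite ler_pM2r// /K; lra.
by rewrite mulrBl; lra.
Unshelve. all: end_near. Qed.

(** If the values at [x] differ, the smaller function stays below for small [h]; at a tie the
    smaller slope wins. *)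
Lemma germ_min g k x s m n : germ g x s m -> germ k x s n ->
  exists m', germ (fun y => Num.min (g y) (k y)) x s m'.
Proof.
move=> gm kn; case: (ltgtP (g x) (k x)) => gk.
- exists m; near=> h; have -> : g (x + s * h) = g x + m * h by near: h.
  have -> : k (x + s * h) = k x + n * h by near: h.
  rewrite (min_idPl (ltW gk)); apply/min_idPl.
  by near: h; exact: near_lt_affine.
- exists n; near=> h; have -> : g (x + s * h) = g x + m * h by near: h.
  have -> : k (x + s * h) = k x + n * h by near: h.
  rewrite (min_idPr (ltW gk)); apply/min_idPr.
  by near: h; exact: near_lt_affine.
- exists (Num.min m n); near=> h.
  have h0 : 0 < h by [].
  have -> : g (x + s * h) = g x + m * h by near: h.
  have -> : k (x + s * h) = k x + n * h by near: h.
  by rewrite gk minxx -addr_minr minr_pMl ?ltW.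
Unshelve. all: end_near. Qed.

(** A pointwise form of piecewise affinity. Sums and minima can be treated one point at a time,
    without refining two subdivisions to a common one. *)
Definition germs a b g :=
  (forall x, a <= x < b -> exists m, germ g x 1 m) /\
  (forall x, a < x <= b -> exists m, germ g x (-1) m).

(** A recursive form of [piecewise_affine], suited to induction on the subdivision. *)
Fixpoint affine_steps a (t : seq R) g : Prop :=
  if t is x :: t' then [/\ a < x, affine_on a x g & affine_steps x t' g]
  else True.

Lemma affine_stepsP a b g : piecewise_affine a b g <->
  exists2 t, affine_steps a t g & last a t = b.
Proof.
split=> -[t].
  case=> pt lt H; exists t => //; elim: t a pt {lt} H => //= x t IH a.
  move=> /andP[ax xt] H; split => //; first exact: (H 0).
  apply: IH => // i it; have := H i.+1 it; rewrite /=.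
  case: t it {H xt} => // y t it.
  by rewrite (set_nth_default x)//= ?(set_nth_default x a) // ltnW.
move=> H lt; exists t; split => //.
  by elim: t a H {lt} => //= x t IH a [-> _ /IH].
elim: t a H {lt} => //= x t IH a [ax gx H] [|i] it //=.
have := IH _ H i it.
case: t it {H IH} => // y t it.
by rewrite (set_nth_default x)//= ?(set_nth_default x a) // ltnW.
Qed.

Lemma affine_steps_le a t g : affine_steps a t g -> a <= last a t.
Proof.
by elim: t a => //= x t IH a [ax _ /IH]; apply: le_trans; exact: ltW.
Qed.

Lemma affine_steps_rcons a t b g : affine_steps a t g -> last a t < b ->
  affine_on (last a t) b g -> affine_steps a (rcons t b) g.
Proof.
elim: t a => [|x t IH] a /=; first by [].
by move=> [ax gx tg] tb bg; split => //; exact: IH.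
Qed.

Lemma piecewise_affine_germs a b g : piecewise_affine a b g -> germs a b g.
Proof.
move=> /affine_stepsP[t + <-]; elim: t a => [|y t IH] a /=.
  by move=> _; split=> x; case: ltgtP => //=; lra.
move=> [ay [c [m gE]] tg].
have [IHr IHl] := IH _ tg; have yt := affine_steps_le _ _ _ tg.
split=> x /andP[ax xb].
  have [xy|yx] := ltP x y; last by apply: IHr; rewrite yx.
  by exists m; apply: (germ_right a y _ c _ _ gE); rewrite ax.
have [yx|xy] := ltP y x; first by apply: IHl; rewrite yx.
by exists (- m); apply: (germ_left a y _ c _ _ gE); rewrite ax.
Qed.

(** A supremum argument replaces compactness. Let [S] be the supremum of the points up to which [g]
    is piecewise affine. The left germ at [S] shows that [S] is such a point, and if [S < b] the
    right germ at [S] would lead past it. *)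
Lemma germs_piecewise_affine a b g : a <= b -> germs a b g ->
  piecewise_affine a b g.
Proof.
move=> ab [gr gl].
pose A := [set x | a <= x <= b /\ piecewise_affine a x g].
have Aa : A a by split; [rewrite lexx|exists [::]].
have Aub : ubound A b by move=> x [/andP[]].
have supA : has_sup A by split; [exists a|exists b].
pose S := sup A.
have aS : a <= S by exact: (sup_upper_bound supA).
have Sb : S <= b by apply: ge_sup => //; exists a.
have AS : A S.
  have [<-//|aS'] := eqVneq a S.
  have {aS'} aS' : a < S by rewrite lt_neqAle aS' aS.
  have [|m /germ_ex[e e0 ge]] := gl S; first by rewrite aS'.
  have [x Ax xS] := sup_adherent e0 supA.
  have xS' : x <= S by exact: (sup_upper_bound supA).
  move: xS'; rewrite le_eqVlt => /predU1P[<-//|xS'].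
  split; first by rewrite aS.
  have [_ /affine_stepsP[t tg tx]] := Ax.
  apply/affine_stepsP; exists (rcons t S); last by rewrite last_rcons.
  apply: affine_steps_rcons; rewrite ?tx//.
  exists (g S + m * S), (- m) => y /andP[xy yS].
  have -> : y = S + -1 * (S - y) by ring.
  by rewrite ge; [ring|move: xS; rewrite -/S; lra].
move: Sb; rewrite le_eqVlt => /predU1P[<-|Sb]; first by case: AS.
exfalso.
have [|m /germ_ex[e e0 ge]] := gr S; first by rewrite aS.
(* The cap at [b] keeps the extended subdivision inside the interval. *)
pose y := Num.min (S + e) b.
have Sy : S < y by rewrite lt_min Sb andbT; lra.
have yb : y <= b by rewrite /y ge_min lexx orbT.
have ye : y <= S + e by rewrite /y ge_min lexx.
suff Ay : A y by have : y <= S; [exact: (sup_upper_bound supA)|lra].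
split; first by apply/andP; split => //; lra.
have [_ /affine_stepsP[t tg tx]] := AS.
apply/affine_stepsP; exists (rcons t y); last by rewrite last_rcons.
apply: affine_steps_rcons; rewrite ?tx//.
exists (g S - m * S), m => z /andP[Sz zy].
have -> : z = S + 1 * (z - S) by ring.
by rewrite ge; [ring|lra].
Qed.

(** At a breakpoint the hypothesis makes the two adjacent slopes equal, and the common value there
    makes the constant terms equal, so neighbouring pieces merge. *)
Lemma piecewise_affine_smooth a b g : piecewise_affine a b g ->
  (forall x m m', a < x < b -> germ g x 1 m -> germ g x (-1) m' -> m + m' = 0) ->
  affine_on a b g.
Proof.
move=> /affine_stepsP[t + <-]; elim: t a => [|y t IH] a /=.
  move=> _ _; exists (g a), 0 => x; rewrite -eq_le => /eqP <-.
  by rewrite mul0r addr0.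
move=> [ay [c [m gE]] tg] H.
have := affine_steps_le _ _ _ tg; rewrite le_eqVlt => /predU1P[<-|yt].
  by exists c, m.
have [|c' [m' gE']] := IH _ tg.
  by move=> x p p' /andP[yx xt]; apply: H; rewrite xt (lt_trans ay).
have g1 : germ g y 1 m' by apply: (germ_right _ _ _ _ _ _ gE'); rewrite lexx.
have g2 : germ g y (-1) (- m).
  by apply: (germ_left _ _ _ _ _ _ gE); rewrite lexx andbT.
have mm' : m' = m by have := H _ _ _ _ g1 g2; rewrite ay yt => /(_ isT); lra.
subst m'; have := gE y; rewrite gE' ?lexx ?ltW// => /(_ isT) cc'.
exists c, m => x /andP[ax xt]; have [xy|yx] := leP x y; first by rewrite gE ?ax.
by rewrite gE' ?xt ?ltW//; lra.
Qed.

(** * Continuity, closure properties and integrals of piecewise affine functions *)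

Lemma germ_cvg g x s m : germ g x s m -> g (x + s * h) @[h --> 0^'+] --> g x.
Proof.
move=> gm.
have : (fun h => g x + m * h) @ (0 : R)^'+ --> g x + m * 0.
  apply: cvg_at_right_filter; apply: cvgD; first exact: cvg_cst.
  by apply: cvgM; [exact: cvg_cst|exact: cvg_id].
rewrite mulr0 addr0; apply: cvg_trans; apply: near_eq_cvg.
by apply: filterS gm => h ->.
Qed.

Lemma germs_continuous a b g : a < b -> germs a b g ->
  {within `[a, b], continuous g}.
Proof.
move=> ab [gr gl].
have cr x : a <= x < b -> g @ x^'+ --> g x.
  move=> /gr[m /germ_cvg gm] A A0; apply/nbhs_right0P.
  have : \forall h \near 0^'+, A (g (x + 1 * h)) := gm A A0.
  by apply: filterS => h; rewrite /= mul1r.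
have cl x : a < x <= b -> g @ x^'- --> g x.
  move=> /gl[m /germ_cvg gm] A A0; apply/nbhs_left0P.
  have : \forall h \near 0^'+, A (g (x + -1 * h)) := gm A A0.
  by apply: filterS => h; rewrite /= mulN1r.
apply/continuous_within_itvP => //; split.
- move=> x; rewrite in_itv/= => /andP[ax xb].
  apply/left_right_continuousP; split; first by apply: cl; rewrite ax ltW.
  by apply: cr; rewrite xb ltW.
- by apply: cr; rewrite lexx.
- by apply: cl; rewrite lexx andbT.
Qed.

Lemma germs_integrable a b g : a < b -> germs a b g ->
  lebesgue_measure.-integrable `[a, b] (EFin \o g).
Proof.
move=> ab gg; apply: continuous_compact_integrable; first exact: segment_compact.
exact: germs_continuous.
Qed.

Lemma germsD a b g k : germs a b g -> germs a b k ->
  germs a b (fun x => g x + k x).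
Proof.
move=> [gr gl] [kr kl]; split=> x xab.
  by have [[m ?] [n ?]] := (gr x xab, kr x xab); exists (m + n); exact: germD.
by have [[m ?] [n ?]] := (gl x xab, kl x xab); exists (m + n); exact: germD.
Qed.

Lemma germsZ c a b g : germs a b g -> germs a b (fun x => c * g x).
Proof.
by move=> [gr gl]; split=> x xab;
  [have [m gm] := gr x xab|have [m gm] := gl x xab]; exists (c * m); exact: germZ.
Qed.

Lemma germs_cst a b c : germs a b (fun=> c).
Proof. by split=> x _; exists 0; exact: germ_cst. Qed.

Lemma germs_min a b g k : germs a b g -> germs a b k ->
  germs a b (fun x => Num.min (g x) (k x)).
Proof.
move=> [gr gl] [kr kl]; split=> x xab.
  by have [[m gm] [n kn]] := (gr x xab, kr x xab); exact: germ_min gm kn.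
by have [[m gm] [n kn]] := (gl x xab, kl x xab); exact: germ_min gm kn.
Qed.

Lemma germs_affine a b g : affine_on a b g -> germs a b g.
Proof.
move=> [c [m gE]]; split => x xab.
  by exists m; exact: germ_right gE xab.
by exists (- m); exact: germ_left gE xab.
Qed.

Lemma germs_eq a b g k : (forall x, a <= x <= b -> g x = k x) ->
  germs a b g -> germs a b k.
Proof.
move=> gk [gr gl]; split=> x xab.
  have [m gm] := gr x xab; exists m; apply: (germ_eq _ _ _ _ _ (b - x) _ _ gm); first lra.
  by move=> h he; apply: gk; lra.
have [m gm] := gl x xab; exists m; apply: (germ_eq _ _ _ _ _ (x - a) _ _ gm); first lra.
by move=> h he; apply: gk; lra.
Qed.

Lemma germs_pos_near a b g x : a < b -> germs a b g -> a <= x <= b -> 0 < g x ->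
  exists p q, [/\ a <= p, p < q, q <= b &
    forall y, p <= y <= q -> g x / 2 <= g y].
Proof.
move=> ab [gr gl] xab gx0.
have gx2 : g x / 2 < g x by lra.
have [xb|bx] := ltP x b.
  have [|m gm] := gr x; first by rewrite xb; lra.
  (* The bound [g x / 2 <= g y] is encoded as the truncated function having slope 0, so that
     [germ_ex] turns it into a bound on a closed interval. At [x = b] the same is done to the
     left. *)
  have : germ (fun y => Num.min (g x / 2) (g y)) x 1 0.
    near=> h; rewrite (min_idPl (ltW gx2)) mul0r addr0; apply/min_idPl.
    have -> : g (x + 1 * h) = g x + m * h by near: h.
    by near: h; apply: filterS (near_lt_affine _ _ 0 m gx2) => h; rewrite mul0r addr0.
  move=> /germ_ex[e e0 ge].
  exists x, (Num.min (x + e) b).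
  split; rewrite ?lt_min ?ge_min ?lexx ?orbT//; [lra|lra|].
  move=> y; rewrite le_min => /and3P[xy ye yb].
  have := ge (y - x); have -> : x + 1 * (y - x) = y by ring.
  rewrite mul0r addr0 (min_idPl (ltW gx2)).
  by move=> <-; [rewrite ge_min lexx orbT|lra].
have [|m gm] := gl x; first by lra.
have : germ (fun y => Num.min (g x / 2) (g y)) x (-1) 0.
  near=> h; rewrite (min_idPl (ltW gx2)) mul0r addr0; apply/min_idPl.
  have -> : g (x + -1 * h) = g x + m * h by near: h.
  by near: h; apply: filterS (near_lt_affine _ _ 0 m gx2) => h; rewrite mul0r addr0.
move=> /germ_ex[e e0 ge].
exists (Num.max (x - e) a), x.
split; rewrite ?gt_max ?le_max ?lexx ?orbT//; [lra|lra|].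
move=> y; rewrite ge_max => /andP[/andP[xy ye] yb].
have := ge (x - y); have -> : x + -1 * (x - y) = y by ring.
rewrite mul0r addr0 (min_idPl (ltW gx2)).
by move=> <-; [rewrite ge_min lexx orbT|lra].
Unshelve. all: end_near. Qed.

(** A positive value would bound [g] below by a positive constant on a nondegenerate subinterval,
    and hence make the integral positive. *)
Lemma germs_Rintegral_le0 a b g : a < b -> germs a b g ->
  (forall x, a <= x <= b -> 0 <= g x) ->
  \int[lebesgue_measure]_(x in `[a, b]) g x <= 0 ->
  forall x, a <= x <= b -> g x = 0.
Proof.
move=> ab gg g0 Ig x xab; apply/eqP; rewrite eq_le g0// andbT leNgt.
apply/negP => gx0.
have [p [q [ap pq qb gpq]]] := germs_pos_near _ _ _ _ ab gg xab gx0.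
have /measurable_int mg := germs_integrable _ _ _ ab gg.
have fI : (\int[lebesgue_measure]_(x in `[a, b]) (g x)%:E)%E \is a fin_num.
  exact: integrable_fin_num (germs_integrable _ _ _ ab gg).
have sub : `[p, q] `<=` `[a, b].
  by move=> y /=; rewrite !in_itv/=; lra.
move: Ig; rewrite leNgt => /negP; apply.
rewrite /Rintegral -lte_fin fineK//.
apply: (@lt_le_trans _ _ (\int[lebesgue_measure]_(y in `[p, q]) (g x / 2)%:E)%E).
  rewrite integral_cst//= lebesgue_measure_itv/= lte_fin pq.
  by rewrite -EFinD -EFinM lte_fin mulr_gt0// ?divr_gt0// subr_gt0.
apply: (@le_trans _ _ (\int[lebesgue_measure]_(y in `[p, q]) (g y)%:E)%E).
  apply: ge0_le_integral => //=.
  - by move=> y _; rewrite lee_fin divr_ge0// ltW.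
  - by apply: measurable_funS mg.
exact: ge0_subset_integral.
Qed.

End RealFunctions.

(** * Piecewise linear functions on the graph and the linearity of the Laplacian *)

Section Graph.
Context {R : realType} {G : metric_graph R}.
Implicit Types (f g : gpoint G -> R) (e : edge G) (p : gpoint G) (x : R).

Lemma epoint0 e : epoint e 0 = inl (esrc e).
Proof. by rewrite /epoint insubF ?lexx//= ltxx. Qed.

Lemma epointl e : epoint e (elen e) = inl (etgt e).
Proof. by rewrite /epoint insubF ?leNgt ?elen_gt0//= ltxx andbF. Qed.

Lemma epoint_in (q : {q : edge G * R | 0 < q.2 < elen q.1}) :
  epoint (val q).1 (val q).2 = inr q.
Proof.
case: q => -[e x] /= ex; rewrite /epoint insubT/=; congr inr; exact: val_inj.
Qed.

Lemma epoint_inE e x (ex : 0 < x < elen e) : epoint e x = inr (exist _ (e, x) ex).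
Proof. exact: (epoint_in (exist _ (e, x) ex)). Qed.

Lemma PLP f : PL f <-> forall e, germs 0 (elen e) (f \o epoint e).
Proof.
split=> fP e; first exact: piecewise_affine_germs.
by apply: germs_piecewise_affine; rewrite ?ltW ?elen_gt0.
Qed.

Lemma PL_cst c : PL (fun _ : gpoint G => c).
Proof. by apply/PLP => e; exact: germs_cst. Qed.

Lemma PLD f g : PL f -> PL g -> PL (fun p => f p + g p).
Proof. by move=> /PLP fP /PLP gP; apply/PLP => e; exact: germsD. Qed.

Lemma PLZ c f : PL f -> PL (fun p => c * f p).
Proof. by move=> /PLP fP; apply/PLP => e; exact: germsZ. Qed.

Lemma PL_min f g : PL f -> PL g -> PL (fun p => Num.min (f p) (g p)).
Proof. by move=> /PLP fP /PLP gP; apply/PLP => e; exact: germs_min. Qed.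

Lemma PL_addcst c f : PL f -> PL (fun p => f p + c).
Proof. by move=> fP; apply: PLD fP (PL_cst c). Qed.

Lemma PLB f g : PL f -> PL g -> PL (fun p => f p - g p).
Proof.
move=> fP /(PLZ (-1)) gP; have := PLD _ _ fP gP.
by under eq_fun do rewrite mulN1r.
Qed.

Lemma germ_slope {f e x s m} : germ (f \o epoint e) x s m -> slope f e x s = m.
Proof. exact: germ_lim. Qed.

(** The tangent directions along [e]: exactly the ones whose slopes enter [sum_slopes], with a
    single one at each end of the edge. *)
Definition is_direction e x (s : R) :=
  (s == 1) && (0 <= x < elen e) || (s == -1) && (0 < x <= elen e).

Lemma is_direction_src e : is_direction e 0 1.
Proof. by rewrite /is_direction eqxx lexx elen_gt0. Qed.

Lemma is_direction_tgt e : is_direction e (elen e) (-1).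
Proof. by rewrite /is_direction eqxx lexx elen_gt0 orbT. Qed.

Lemma is_direction_in (q : {q : edge G * R | 0 < q.2 < elen q.1}) :
  is_direction (val q).1 (val q).2 1 /\ is_direction (val q).1 (val q).2 (-1).
Proof.
case: q => -[e x] /= /andP[x0 xl]; rewrite /is_direction !eqxx !(ltW x0) x0 xl.
by rewrite ltW ?orbT.
Qed.

Lemma PL_germ f e x s : PL f -> is_direction e x s ->
  germ (f \o epoint e) x s (slope f e x s).
Proof.
move=> /PLP/(_ e)[fr fl] /orP[]/andP[/eqP -> ex].
  by have [m fm] := fr x ex; rewrite (germ_slope fm).
by have [m fm] := fl x ex; rewrite (germ_slope fm).
Qed.

(** The Laplacian reads a function only through its slopes in tangent directions, so the linearity
    rules below reduce to statements about germs. *)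
Lemma laplacian_comb f g k a b :
  (forall e x s, is_direction e x s ->
    slope k e x s = a * slope f e x s + b * slope g e x s) ->
  laplacian k = fun p => a * laplacian f p + b * laplacian g p.
Proof.
move=> kE; apply/funext => -[v|q]; rewrite /laplacian /sum_slopes.
  under eq_bigr do rewrite kE ?is_direction_src//.
  under [X in - (_ + X)]eq_bigr do rewrite kE ?is_direction_tgt//.
  by rewrite !big_split/= -!mulr_sumr; ring.
by have [q1 q2] := is_direction_in q; rewrite !kE//; ring.
Qed.

Lemma laplacianD f g : PL f -> PL g ->
  laplacian (fun p => f p + g p) = fun p => laplacian f p + laplacian g p.
Proof.
move=> fP gP; rewrite (@laplacian_comb f g _ 1 1).
  by apply/funext => p; rewrite !mul1r.
move=> e x s exs; rewrite !mul1r; apply: germ_slope.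
by apply: germD; exact: PL_germ.
Qed.

Lemma laplacianZ c f : PL f ->
  laplacian (fun p => c * f p) = fun p => c * laplacian f p.
Proof.
move=> fP; rewrite (@laplacian_comb f f _ c 0).
  by apply/funext => p; rewrite mul0r addr0.
move=> e x s exs; rewrite mul0r addr0; apply: germ_slope.
by apply: germZ; exact: PL_germ.
Qed.

Lemma laplacian_cst c : laplacian (fun _ : gpoint G => c) = fun=> 0.
Proof.
rewrite (@laplacian_comb (fun=> c) (fun=> c) _ 0 0).
  by apply/funext => p; rewrite !mul0r addr0.
move=> e x s exs; rewrite !mul0r addr0; apply: germ_slope.
exact: germ_cst.
Qed.

Lemma laplacianB f g : PL f -> PL g ->
  laplacian (fun p => f p - g p) = fun p => laplacian f p - laplacian g p.
Proof.
move=> fP gP; under eq_fun do rewrite -mulN1r.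
rewrite laplacianD//; last exact: PLZ.
by rewrite laplacianZ//; apply/funext => p; rewrite mulN1r.
Qed.

Lemma laplacian_addcst c f : PL f -> laplacian (fun p => f p + c) = laplacian f.
Proof.
move=> fP; rewrite laplacianD//; last exact: PL_cst.
by rewrite laplacian_cst; apply/funext => p; rewrite addr0.
Qed.

(** Agreement along the edges is enough even at a vertex without edges, where the Laplacian is an
    empty sum. *)
Lemma eq_laplacian f g : PL f ->
  (forall e x, 0 <= x <= elen e -> f (epoint e x) = g (epoint e x)) ->
  laplacian f = laplacian g.
Proof.
move=> fP fg; rewrite [RHS](@laplacian_comb f f _ 1 0).
  by apply/funext => p; rewrite mul1r mul0r addr0.
move=> e x s exs; rewrite mul1r mul0r addr0; apply: germ_slope.
have fm := PL_germ _ _ _ _ fP exs; move: exs => /orP[]/andP[/eqP sE ex]; subst s.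
  apply: (germ_eq _ _ _ _ _ (elen e - x) _ _ fm); first lra.
  by move=> h he /=; apply: fg; lra.
apply: (germ_eq _ _ _ _ _ x _ _ fm); first lra.
by move=> h he /=; apply: fg; lra.
Qed.

(** Summation by parts: the sum is regrouped by edges, a loop contributing both of its ends. The
    weight [w = f] serves for the energy, [w = 1] for the total mass at the vertices. *)
Lemma sum_slopes_vertices (w : vertex G -> R) f :
  \sum_v w v * sum_slopes f (inl v) =
  \sum_e (w (esrc e) * slope f e 0 1 + w (etgt e) * slope f e (elen e) (-1)).
Proof.
have fiber (h : edge G -> vertex G) (F : edge G -> R) :
    \sum_v w v * \sum_(e | h e == v) F e = \sum_e w (h e) * F e.
  under eq_bigr do rewrite mulr_sumr big_mkcond.
  rewrite exchange_big/=; apply: eq_bigr => e _.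
  rewrite (bigD1 (h e))//= eqxx big1 ?addr0// => v vh.
  by rewrite eq_sym (negbTE vh).
under eq_bigr do rewrite /= mulrDr.
by rewrite big_split/= !fiber -big_split.
Qed.

Lemma affine_slopes f e : affine_on 0 (elen e) (f \o epoint e) ->
  let m := (f (inl (etgt e)) - f (inl (esrc e))) / elen e in
  [/\ slope f e 0 1 = m, slope f e (elen e) (-1) = - m,
   (forall x, 0 < x < elen e -> slope f e x 1 + slope f e x (-1) = 0) &
   forall x, 0 <= x <= elen e -> f (epoint e x) = f (inl (esrc e)) + m * x].
Proof.
move=> [c [m fE]] /=; have l0 := elen_gt0 e.
have f0 : f (inl (esrc e)) = c.
  by rewrite -epoint0; have := fE 0; rewrite mulr0 addr0 lexx ltW//=; apply.
have fl : f (inl (etgt e)) = c + m * elen e.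
  by rewrite -epointl; apply: fE; rewrite lexx ltW.
have -> : (f (inl (etgt e)) - f (inl (esrc e))) / elen e = m.
  by rewrite fl f0; field; lra.
split.
- by apply: germ_slope; apply: (germ_right _ _ _ _ _ _ fE); rewrite lexx.
- by apply: germ_slope; apply: (germ_left _ _ _ _ _ _ fE); rewrite lexx andbT.
- move=> x /andP[x0 xl].
  have -> : slope f e x 1 = m.
    by apply: germ_slope; apply: (germ_right _ _ _ _ _ _ fE); rewrite xl ltW.
  have -> : slope f e x (-1) = - m.
    by apply: germ_slope; apply: (germ_left _ _ _ _ _ _ fE); rewrite x0 ltW.
  exact: subrr.
- by move=> x xl; rewrite f0; exact: fE.
Qed.

(** * Uniqueness of potentials up to a constant, and attainment of minima *)

Lemma eq_on_adjacent_cst (w : vertex G -> R) :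
  (forall e, w (esrc e) = w (etgt e)) -> forall u v, w u = w v.
Proof.
move=> we u v; have /connectP[t] := @vertex_connected _ G u v.
elim: t u => [u _ ->//|y t IH u /= /andP[/existsP[e ey] yt] vt].
rewrite -(IH y)//.
by case/orP: ey => /andP[/eqP <- /eqP <-].
Qed.

(* Without kinks f is affine on every edge; pairing it with its Laplacian at the
   vertices then gives its energy, the sum of (increment)^2 / length. *)
Lemma harmonic_cst f : PL f -> laplacian f = (fun=> 0) ->
  exists c, forall p, f p = c.
Proof.
move=> fP f0.
have s0 p : sum_slopes f p = 0.
  by have /eqP := congr1 (fun h => h p) f0; rewrite /laplacian oppr_eq0 => /eqP.
have fA e : affine_on 0 (elen e) (f \o epoint e).
  apply: piecewise_affine_smooth => [|x m m' xl fm fm']; first exact: fP.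
  rewrite -(germ_slope fm) -(germ_slope fm').
  exact: (s0 (inr (exist _ (e, x) xl))).
have := sum_slopes_vertices (f \o inl) f.
rewrite big1; last by move=> v _; rewrite s0 mulr0.
pose dl e := f (inl (etgt e)) - f (inl (esrc e)).
under eq_bigr => e _.
  have [-> -> _ _] := affine_slopes _ _ (fA e).
  rewrite (_ : _ + _ = - (dl e ^+ 2 / elen e)); last first.
    by rewrite /dl /=; field; rewrite gt_eqF ?elen_gt0.
  over.
rewrite sumrN => /esym/eqP; rewrite oppr_eq0 => /eqP E0.
have dl0 e : f (inl (esrc e)) = f (inl (etgt e)).
  have : dl e ^+ 2 / elen e = 0.
    apply: (psumr_eq0P _ E0) => // e' _.
    by rewrite divr_ge0 ?sqr_ge0// ltW// elen_gt0.
  move=> /eqP; rewrite mulf_eq0 invr_eq0 (gt_eqF (elen_gt0 e)) orbF sqrf_eq0.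
  by rewrite subr_eq0 => /eqP.
have fc := eq_on_adjacent_cst (f \o inl) dl0.
have [v _] : exists v, v \in vertex G by apply/card_gt0P; exact: vertex_gt0.
exists (f (inl v)) => -[u|q]; first exact: fc.
rewrite -epoint_in; case: q => -[e x] /= /andP[x0 xl].
have [_ _ _ ->] := affine_slopes _ _ (fA e); last by rewrite !ltW.
by rewrite dl0 subrr !mul0r addr0; exact: fc.
Qed.

Lemma laplacian_inj f g : PL f -> PL g -> laplacian f = laplacian g ->
  exists c, forall p, f p = g p + c.
Proof.
move=> fP gP fg; have [|c fgc] := harmonic_cst _ (PLB _ _ fP gP).
  by rewrite laplacianB// fg; apply/funext => p; rewrite subrr.
by exists c => p; rewrite -(fgc p) addrC subrK.
Qed.

Lemma PL_min_attained f : PL f -> exists p, forall q, f p <= f q.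
Proof.
move=> /PLP fP.
have xE e : exists x, [/\ 0 <= x <= elen e &
    forall y, 0 <= y <= elen e -> f (epoint e x) <= f (epoint e y)].
  have l0 := elen_gt0 e.
  have [x] := EVT_min (ltW l0) (germs_continuous _ _ _ l0 (fP e)).
  by rewrite in_itv => xl fx; exists x; split => // y yl; apply: fx; rewrite in_itv.
have [X XP] := choice xE.
have [v _] : exists v, v \in vertex G by apply/card_gt0P; exact: vertex_gt0.
(* Finitely many candidates: a minimum point on each edge, and all the vertices, since the graph may
   have no edge. *)
pose P (i : vertex G + edge G) : gpoint G :=
  match i with inl v => inl v | inr e => epoint e (X e) end.
case: (@Order.TotalTheory.arg_minP _ _ _ (inl v) predT (f \o P)) => // i _ fi.
exists (P i) => -[u|q]; first exact: (fi (inl u)).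
rewrite -epoint_in; apply: le_trans (fi (inr (val q).1) isT) _.
by apply: (XP (val q).1).2; case: q => /= r /andP[? ?]; rewrite !ltW.
Qed.

End Graph.

(** * Existence of potentials *)

Section Existence.
Context {R : realType} {G : metric_graph R}.
Local Notation ipoint := {q : edge G * R | 0 < q.2 < elen q.1}.
Implicit Types (f g : gpoint G -> R) (e : edge G) (p : gpoint G) (x : R).

Lemma sum_laplacian_vertices f : \sum_v laplacian f (inl v) =
  - \sum_e (slope f e 0 1 + slope f e (elen e) (-1)).
Proof.
rewrite sumrN; congr (- _); under eq_bigr do rewrite -[sum_slopes _ _]mul1r.
rewrite (sum_slopes_vertices (fun=> 1)).
by apply: eq_bigr => e _; rewrite !mul1r.
Qed.

(** The affine extension along edges; its Laplacian at the vertices is the weighted graph Laplacian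
    of [w], with weights the inverse lengths. *)
Definition interp (w : vertex G -> R) : gpoint G -> R := fun p =>
  match p with
  | inl v => w v
  | inr q => let e := (val q).1 in
     w (esrc e) + (w (etgt e) - w (esrc e)) / elen e * (val q).2
  end.

Lemma interp_epoint w e x : 0 <= x <= elen e ->
  interp w (epoint e x) = w (esrc e) + (w (etgt e) - w (esrc e)) / elen e * x.
Proof.
move=> /andP[]; rewrite le_eqVlt => /predU1P[<- _|x0].
  by rewrite epoint0 /= mulr0 addr0.
rewrite le_eqVlt => /predU1P[->|xl]; last first.
  by rewrite epoint_inE ?x0// => ex.
by rewrite epointl/= divfK ?gt_eqF ?elen_gt0// addrC subrK.
Qed.

Lemma interp_affine w e : affine_on 0 (elen e) (interp w \o epoint e).
Proof.
by exists (w (esrc e)), ((w (etgt e) - w (esrc e)) / elen e) => x; exact: interp_epoint.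
Qed.

Lemma PL_interp w : PL (interp w).
Proof. by apply/PLP => e; apply: germs_affine; exact: interp_affine. Qed.

Lemma laplacian_interp_in w (q : ipoint) : laplacian (interp w) (inr q) = 0.
Proof.
have [_ _ H _] := affine_slopes _ _ (interp_affine w (val q).1).
by rewrite /laplacian /= H ?oppr0//; exact: valP q.
Qed.

Lemma sum_laplacian_interp w : \sum_v laplacian (interp w) (inl v) = 0.
Proof.
rewrite sum_laplacian_vertices big1 ?oppr0// => e _.
by have [-> -> _ _] := affine_slopes _ _ (interp_affine w e); rewrite subrr.
Qed.

Lemma laplacian_interp_lin a (w w' : vertex G -> R) v :
  laplacian (interp (fun u => a * w u + w' u)) v =
  a * laplacian (interp w) v + laplacian (interp w') v.
Proof.
have -> : interp (fun u => a * w u + w' u) =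
    (fun p => a * interp w p + interp w' p).
  by apply/funext => -[u|q]//=; ring.
rewrite laplacianD; [|by apply: PLZ; exact: PL_interp|exact: PL_interp].
by rewrite laplacianZ//; exact: PL_interp.
Qed.

Local Notation V := {ffun vertex G -> R^o}.

(* Adding the rank one term makes the vertex Laplacian invertible, without
   affecting the solutions for a right-hand side of total mass 0. *)
Definition vertex_op (v0 : vertex G) (w : V) : V :=
  [ffun v => laplacian (interp w) (inl v) + (\sum_u w u) * (v == v0)%:R].

Lemma vertex_op_linear v0 : linear (vertex_op v0).
Proof.
move=> a w w'; apply/ffunP => v; rewrite !ffunE.
have -> : interp (a *: w + w') = interp (fun u => a * w u + w' u).
  by congr interp; apply/funext => u; rewrite !ffunE.
rewrite laplacian_interp_lin; under eq_bigr do rewrite !ffunE.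
rewrite big_split/= -scaler_sumr /GRing.scale/=; ring.
Qed.

(** The Laplacian part has total mass 0, so only the rank one term counts. For a right-hand side of
    mass 0 that term therefore vanishes. *)
Lemma sum_vertex_op v0 w : \sum_v vertex_op v0 w v = \sum_v w v.
Proof.
under eq_bigr do rewrite ffunE.
rewrite big_split/= sum_laplacian_interp add0r -mulr_sumr.
suff -> : \sum_v (v == v0)%:R = 1 :> R by rewrite mulr1.
by rewrite (bigD1 v0)//= eqxx big1 ?addr0// => v /negbTE ->.
Qed.

(** [vertex_op] is injective, hence invertible in finite dimension: an element of its kernel has sum
    0, so its interpolation is harmonic, thus constant, and the constant is 0 because the sum is. *)
Lemma vertex_poisson (W : vertex G -> R) : \sum_v W v = 0 ->
  exists w, forall v, laplacian (interp w) (inl v) = W v.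
Proof.
move=> W0.
have [v0 _] : exists v, v \in vertex G by apply/card_gt0P; exact: vertex_gt0.
pose L : {linear V -> V} := HB.pack (vertex_op v0)
  (GRing.isLinear.Build R V V *:%R (vertex_op v0) (vertex_op_linear v0)).
have L0 : lker (linfun L) == 0%VS.
  rewrite -subv0; apply/subvP => w; rewrite memv_ker memv0 lfunE/= => /eqP Lw.
  have sw : \sum_v w v = 0.
    by rewrite -(sum_vertex_op v0) Lw big1// => v _; rewrite ffunE.
  have [|c wc] := harmonic_cst (interp w) (PL_interp w).
    apply/funext => -[v|q]; last exact: laplacian_interp_in.
    by have := congr1 (fun h : V => h v) Lw; rewrite !ffunE sw mul0r addr0.
  have {}wc v : w v = c by exact: (wc (inl v)).
  move: sw; under eq_bigr do rewrite wc.
  rewrite sumr_const => /eqP; rewrite mulrn_eq0.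
  rewrite -(negbK (_ == 0)%N) -lt0n vertex_gt0/= => /eqP c0.
  by apply/eqP/ffunP => v; rewrite wc c0 ffunE.
pose Wf : V := [ffun v => W v].
pose w := ((linfun L)^-1 Wf)%VF.
have LwE : vertex_op v0 w = Wf.
  by have := lker0_lfunVK L0 Wf; rewrite -/w lfunE.
have sw : \sum_v w v = 0.
  rewrite -(sum_vertex_op v0) LwE -[RHS]W0.
  by apply: eq_bigr => v _; rewrite ffunE.
exists w => v; have := congr1 (fun h : V => h v) LwE.
by rewrite !ffunE sw mul0r addr0.
Qed.

(** The Green function of the edge of [q0] with value 0 at both ends, extended by 0. Its slopes
    [(l - x0) / l] and [- x0 / l] drop by exactly 1 at [q0]. *)
Definition hat (q0 : ipoint) : gpoint G -> R := fun p =>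
  match p with
  | inl v => 0
  | inr q => let x := (val q).2 in let x0 := (val q0).2 in
     let l := elen (val q0).1 in
     if (val q).1 == (val q0).1 then l^-1 * Num.min ((l - x0) * x) (x0 * (l - x))
     else 0
  end.

Lemma hat_epoint_neq q0 e x : e != (val q0).1 -> 0 <= x <= elen e ->
  hat q0 (epoint e x) = 0.
Proof.
move=> eN /andP[]; rewrite le_eqVlt => /predU1P[<- _|x0]; first by rewrite epoint0.
rewrite le_eqVlt => /predU1P[->|xl]; first by rewrite epointl.
by rewrite epoint_inE ?x0// => ex /=; rewrite (negbTE eN).
Qed.

Lemma hat_epoint q0 x : let x0 := (val q0).2 in let l := elen (val q0).1 in
  0 <= x <= l -> hat q0 (epoint (val q0).1 x) =
  l^-1 * Num.min ((l - x0) * x) (x0 * (l - x)).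
Proof.
case: q0 => -[e x0] /= ex0 /andP[]; rewrite le_eqVlt => /predU1P[<- _|x_gt0].
  by rewrite epoint0 mulr0 subr0 (min_idPl _) ?mulr0// mulr_ge0//; lra.
rewrite le_eqVlt => /predU1P[->|xl].
  by rewrite epointl subrr mulr0 (min_idPr _) ?mulr0// mulr_ge0//; lra.
by rewrite epoint_inE ?x_gt0// => ex /=; rewrite eqxx.
Qed.

Lemma hat_slopes q0 : let x0 := (val q0).2 in let l := elen (val q0).1 in
  (forall x, 0 <= x <= x0 ->
     hat q0 (epoint (val q0).1 x) = 0 + ((l - x0) / l) * x) /\
  (forall x, x0 <= x <= l -> hat q0 (epoint (val q0).1 x) = x0 + (- x0 / l) * x).
Proof.
move=> x0 l.
have /andP[x00 x0l] : 0 < x0 < l := valP q0.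
have l0 : l != 0 by lra.
split=> x /andP[ax xb]; rewrite hat_epoint -/x0 -/l ?ax ?xb; try lra.
  rewrite (min_idPl _) ?add0r; first by field.
  have : x * l <= x0 * l by rewrite ler_wpM2r//; lra.
  lra.
rewrite (min_idPr _); first by field.
have : x0 * l <= x * l by rewrite ler_wpM2r//; lra.
lra.
Qed.

Lemma PL_hat q0 : PL (hat q0).
Proof.
apply/PLP => e; have [->|eN] := eqVneq e (val q0).1.
  apply: (germs_eq _ _ _ _ (fun x xl => esym (hat_epoint q0 x xl))).
  apply: germsZ; apply: germs_min; apply: germs_affine.
    by exists 0, (elen (val q0).1 - (val q0).2) => x _; rewrite add0r.
  exists ((val q0).2 * elen (val q0).1), (- (val q0).2) => x _; ring.
apply: (germs_eq _ _ _ _ (fun x xl => esym (hat_epoint_neq q0 e x eN xl))).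
exact: germs_cst.
Qed.

Lemma laplacian_hat_in (q0 q : ipoint) :
  laplacian (hat q0) (inr q) = (q == q0)%:R.
Proof.
rewrite /laplacian /=; have /andP[x_gt0 xl] := valP q.
have /andP[x00 x0l] := valP q0.
have [eE|eN] := eqVneq (val q).1 (val q0).1; last first.
  have hA : affine_on 0 (elen (val q).1) (hat q0 \o epoint (val q).1).
    exists 0, 0 => x xl'; rewrite mul0r addr0; exact: hat_epoint_neq.
  have [_ _ H _] := affine_slopes _ _ hA; rewrite H; last exact: valP q.
  by case: eqP => [qq0|]; [rewrite qq0 eqxx in eN|rewrite oppr0].
have [hl hr] := hat_slopes q0.
have -> : (q == q0) = ((val q).2 == (val q0).2).
  by rewrite -val_eqE /= -pair_eqE /= eE eqxx.
rewrite eE in xl *; set l := elen _ in xl x0l hl hr *.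
set x := (val q).2 in xl x_gt0 *; set x0 := (val q0).2 in x00 x0l hl hr *.
have l0 : l != 0 by rewrite gt_eqF// (lt_trans x00).
case: (@ltgtP _ R x x0) => xx0.
- rewrite (germ_slope (germ_right _ _ _ _ _ _ hl _)); last by rewrite xx0 ltW.
  rewrite (germ_slope (germ_left _ _ _ _ _ _ hl _)); last by rewrite x_gt0 ltW.
  by rewrite subrr oppr0.
- rewrite (germ_slope (germ_right _ _ _ _ _ _ hr _)); last by rewrite xl ltW.
  rewrite (germ_slope (germ_left _ _ _ _ _ _ hr _)); last by rewrite xx0 ltW.
  by rewrite subrr oppr0.
- rewrite xx0 (germ_slope (germ_right _ _ _ _ _ _ hr _)); last by rewrite x0l lexx.
  rewrite (germ_slope (germ_left _ _ _ _ _ _ hl _)); last by rewrite x00 lexx.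
  by rewrite /=; field.
Qed.

(** The slopes leaving the two ends of the edge, [(l - x0) / l] and [x0 / l], add up to 1; this
    balances the unit mass at [q0]. *)
Lemma sum_laplacian_hat q0 : \sum_v laplacian (hat q0) (inl v) = -1.
Proof.
have /andP[x00 x0l] := valP q0; have [hl hr] := hat_slopes q0.
rewrite sum_laplacian_vertices (bigD1 (val q0).1)//= big1 ?addr0; last first.
  move=> e eN.
  have hA : affine_on 0 (elen e) (hat q0 \o epoint e).
    exists 0, 0 => x xl'; rewrite mul0r addr0; exact: hat_epoint_neq.
  by have [-> -> _ _] := affine_slopes _ _ hA; rewrite subrr.
rewrite (germ_slope (germ_right _ _ _ _ _ _ hl _)); last by rewrite lexx.
rewrite (germ_slope (germ_left _ _ _ _ _ _ hr _)); last by rewrite x0l lexx.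
by field; rewrite gt_eqF ?elen_gt0.
Qed.

Lemma interior_poisson (s : seq ipoint) (c : ipoint -> R) : exists f, [/\ PL f,
  forall q, laplacian f (inr q) = \sum_(q0 <- s) c q0 * (q == q0)%:R &
  \sum_v laplacian f (inl v) = - \sum_(q0 <- s) c q0].
Proof.
elim: s => [|q0 s [f [fP fin fv]]].
  exists (fun=> 0); split; first exact: PL_cst.
    by move=> q; rewrite laplacian_cst big_nil.
  by rewrite laplacian_cst big1 ?big_nil ?oppr0.
have hP := PLZ (c q0) _ (PL_hat q0).
exists (fun p => c q0 * hat q0 p + f p); split; first exact: PLD.
  move=> q; rewrite laplacianD// laplacianZ; last exact: PL_hat.
  by rewrite big_cons laplacian_hat_in fin.
rewrite laplacianD// laplacianZ; last exact: PL_hat.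
by rewrite big_split/= -mulr_sumr sum_laplacian_hat fv big_cons; ring.
Qed.

(** Hat functions realize the interior part of [D]. What remains at the vertices has total mass 0
    and is realized by an interpolation, which adds no mass in the interiors. *)
Lemma poisson (D : gpoint G -> R) (s : seq ipoint) : uniq s ->
  (forall q, q \notin s -> D (inr q) = 0) ->
  \sum_v D (inl v) + \sum_(q <- s) D (inr q) = 0 ->
  exists f, PL f /\ laplacian f = D.
Proof.
move=> us Ds D0.
have [f [fP fin fv]] := interior_poisson s (D \o inr).
have [|w wE] := vertex_poisson (fun v => D (inl v) - laplacian f (inl v)).
  by rewrite big_split/= sumrN fv opprK.
exists (fun p => interp w p + f p); split.
  by apply: PLD => //; exact: PL_interp.
rewrite laplacianD//; last exact: PL_interp.
apply/funext => -[v|q]; first by rewrite wE subrK.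
rewrite laplacian_interp_in add0r fin.
have [qs|qs] := boolP (q \in s).
  rewrite (bigD1_seq q)//= eqxx mulr1 big1 ?addr0// => q' q'q.
  by rewrite eq_sym (negbTE q'q) mulr0.
rewrite Ds// big_seq big1// => q' q's; case: eqP => [E|]; last by rewrite mulr0.
by rewrite E q's in qs.
Qed.

Lemma degreeE (D : gpoint G -> R) (s : seq ipoint) : uniq s ->
  (forall q, q \notin s -> D (inr q) = 0) ->
  degree D = \sum_v D (inl v) + \sum_(q <- s) D (inr q).
Proof.
move=> us Ds; pose r : seq (gpoint G) := map inl (index_enum (vertex G)) ++ map inr s.
rewrite /degree (@fsbigE _ _ _ _ _ r).
- under eq_bigl do rewrite in_setT.
  by rewrite big_cat/= !big_map.
- rewrite cat_uniq !map_inj_uniq ?index_enum_uniq ?us//=; [|by move=> ? ? []..].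
  by rewrite andbT; apply/hasPn => _ /mapP[q _ ->]; apply/negP => /mapP[].
- by [].
- move=> [v|q] _; rewrite mem_cat negb_or.
    by rewrite map_f ?mem_index_enum.
  move=> /andP[_ qs]; apply: Ds; apply: contra qs; exact: map_f.
Qed.

(** A solution exists, so the choice made in [potential] never falls back on its default value. *)
Lemma potentialP {d} (D1 D2 : effdiv G d) :
  PL (potential (mult D2 \- mult D1)) /\
  laplacian (potential (mult D2 \- mult D1)) = mult D2 \- mult D1.
Proof.
pose A (D : effdiv G d) : set ipoint := [set q | mult D (inr q) != 0].
have fA D : finite_set (A D).
  apply: (@finite_preimage _ _ [set p | mult D p != 0] inr).
    by move=> ? ? _ _ [].
  exact: effdiv_divisor.
have fA12 : finite_set (A D1 `|` A D2) by rewrite finite_setU.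
(* One list carries the interior supports of both divisors, so the two degree formulas can be
   subtracted. *)
have /finite_seqP[s0 s0E] := fA12; pose s := undup s0.
have sP D : A D `<=` A D1 `|` A D2 ->
    forall q, q \notin s -> mult D (inr q) = 0.
  move=> AD q; rewrite mem_undup; apply: contraNeq => /AD.
  by rewrite s0E.
have us : uniq s by exact: undup_uniq.
have s1 := sP D1 (@subsetUl _ _ _); have s2 := sP D2 (@subsetUr _ _ _).
have := effdiv_degree D1; rewrite (degreeE _ s)// => d1.
have := effdiv_degree D2; rewrite (degreeE _ s)// => d2.
have ex : exists f, PL f /\ laplacian f = mult D2 \- mult D1.
  apply: (poisson _ s us) => [q qs|]; first by rewrite /= s1// s2// subrr.
  by rewrite /= !big_split/= !sumrN addrACA -opprD d1 d2 subrr.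
exact: (@xgetPex _ (fun=> 0)
  [set f | PL f /\ laplacian f = mult D2 \- mult D1] ex).
Qed.

End Existence.

(** * Extrema and integrals of piecewise linear functions *)

Section Minimizer.
Context {R : realType} {G : metric_graph R}.
Implicit Types (f g F : gpoint G -> R) (e : edge G) (p q : gpoint G) (x : R).

Lemma fmin_attained f p : (forall q, f p <= f q) -> fmin f = f p.
Proof.
move=> fp; apply/eqP; rewrite eq_le; apply/andP; split.
  by apply: ge_inf; [exists (f p) => _ [q _ <-]|exists p].
by apply: lb_le_inf; [exists (f p), p|move=> _ [q _ <-]].
Qed.

Lemma fmax_attained f p : (forall q, f q <= f p) -> fmax f = f p.
Proof.
move=> fp; apply/eqP; rewrite eq_le; apply/andP; split.
  by apply: ge_sup; [exists (f p), p|move=> _ [q _ <-]].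
by apply: ub_le_sup; [exists (f p) => _ [q _ <-]|exists p].
Qed.

Lemma PL_max_attained f : PL f -> exists p, forall q, f q <= f p.
Proof.
move=> /(PLZ (-1))/PL_min_attained[p fp]; exists p => q.
by have := fp q; rewrite !mulN1r lerN2.
Qed.

Lemma PL_oscillation f p q : PL f -> f p - f q <= fmax f - fmin f.
Proof.
move=> fP; have [a fa] := PL_min_attained _ fP; have [b fb] := PL_max_attained _ fP.
rewrite (fmin_attained _ _ fa) (fmax_attained _ _ fb).
by have := fa q; have := fb p; lra.
Qed.

Lemma PL_integrable f e : PL f ->
  lebesgue_measure.-integrable `[0, elen e] (EFin \o (f \o epoint e)).
Proof. by move=> /PLP/(_ e); apply: germs_integrable; exact: elen_gt0. Qed.

Lemma gintegralB f g : PL f -> PL g ->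
  gintegral (fun p => f p - g p) = gintegral f - gintegral g.
Proof.
move=> fP gP; rewrite /gintegral -sumrB; apply: eq_bigr => e _.
by rewrite RintegralB//; exact: PL_integrable.
Qed.

Lemma gintegral_ge0 f : (forall p, 0 <= f p) -> 0 <= gintegral f.
Proof. by move=> f0; apply: sumr_ge0 => e _; apply: Rintegral_ge0. Qed.

Lemma gintegral_le_cst f c : PL f -> (forall p, f p <= c) ->
  gintegral f <= c * \sum_(e : edge G) elen e.
Proof.
move=> fP fc; rewrite mulr_sumr; apply: ler_sum => e _.
have -> : c * elen e = \int[lebesgue_measure]_(x in `[0, elen e]) c.
  rewrite Rintegral_cst//= lebesgue_measure_itv/= lte_fin elen_gt0.
  by rewrite -EFinD/= subr0.
apply: le_Rintegral => //; first exact: PL_integrable.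
exact: (PL_integrable _ _ (PL_cst c)).
Qed.

Lemma gintegral_le0 f : PL f -> (forall p, 0 <= f p) -> gintegral f <= 0 ->
  forall e x, 0 <= x <= elen e -> f (epoint e x) = 0.
Proof.
move=> fP f0 If e; have I0 e' :
    0 <= \int[lebesgue_measure]_(x in `[0, elen e']) f (epoint e' x).
  exact: Rintegral_ge0.
have /eqP : gintegral f = 0 by apply/eqP; rewrite eq_le If gintegral_ge0.
rewrite psumr_eq0// => /allP/(_ e (mem_index_enum _)) /= /eqP Ie.
apply: (@germs_Rintegral_le0 _ 0 (elen e) (f \o epoint e)) => //.
- exact: elen_gt0.
- by have /PLP := fP.
- by move=> x _; exact: f0.
- by rewrite [leLHS]Ie.
Qed.

Definition normalized f := (forall p, 0 <= f p) /\ exists p, f p = 0.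

(** * Continuity of the function to be minimized, and minima along tropical segments *)

Section Degree.
Context {d : R}.
Implicit Types D E : effdiv G d.

(** The chosen potential differs from [F] by a constant, which subtracting the minimum removes. From
    here on any convenient normalized potential can be used. *)
Lemma Sfun_normalized D E F : PL F -> laplacian F = mult D \- mult E ->
  normalized F -> Sfun (mult D \- mult E) = gintegral F.
Proof.
move=> FP Fl [F0 [p Fp]]; have [fP fl] := potentialP E D.
have [c fF] : exists c, forall q, potential (mult D \- mult E) q = F q + c.
  by apply: laplacian_inj => //; rewrite fl.
rewrite /Sfun; congr gintegral; apply/funext => q.
rewrite (@fmin_attained _ p) => [|r]; last by rewrite !fF Fp lerD2r.
by rewrite !fF Fp; ring.
Qed.

Lemma normalize f : PL f -> normalized (fun p => f p - fmin f).
Proof.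
move=> fP; have [p fp] := PL_min_attained _ fP; rewrite (fmin_attained _ _ fp).
by split=> [q|]; [rewrite subr_ge0|exists p; rewrite subrr].
Qed.

Lemma normalized_potential D E :
  exists F, [/\ PL F, laplacian F = mult D \- mult E & normalized F].
Proof.
have [fP fl] := potentialP E D.
exists (fun p => potential (mult D \- mult E) p - fmin (potential (mult D \- mult E))).
split; [exact: PL_addcst|by rewrite laplacian_addcst|exact: normalize].
Qed.

Lemma Sfun_dist D D' E : Sfun (mult D' \- mult E) - Sfun (mult D \- mult E) <=
  rho D D' * \sum_(e : edge G) elen e.
Proof.
have [F [FP Fl Fn]] := normalized_potential D E.
have [F' [F'P F'l F'n]] := normalized_potential D' E.
have [hP hl] := potentialP D D'.
have [|c hc] := laplacian_inj _ _ (PLB _ _ F'P FP) hP.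
  by rewrite laplacianB// F'l Fl hl; apply/funext => p /=; ring.
rewrite (Sfun_normalized _ _ _ FP Fl Fn) (Sfun_normalized _ _ _ F'P F'l F'n).
rewrite -gintegralB//; apply: gintegral_le_cst => [|p]; first exact: PLB.
(* At the zero [q] of [F'] the difference [F' - F] is at most 0, so elsewhere it is at most its
   oscillation, which is [rho D D']. *)
have [[F0 _] [F'0 [q F'q]]] := (Fn, F'n).
have := PL_oscillation _ p q hP; rewrite -/(rho D D').
have := hc p; have := hc q; rewrite F'q; have := F0 q.
lra.
Qed.

(** The two potentials are chosen independently, but one is the negative of the other up to a
    constant. Continuity needs this because [Sfun_dist] is applied in both orders. *)
Lemma rho_sym_le D D' : rho D' D <= rho D D'.
Proof.
have [hP hl] := potentialP D D'; have [kP kl] := potentialP D' D.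
have [|c hc] := laplacian_inj _ _ kP (PLZ (-1) _ hP).
  by rewrite kl laplacianZ// hl; apply/funext => p /=; ring.
have [a ka] := PL_min_attained _ kP; have [b kb] := PL_max_attained _ kP.
rewrite /rho (fmin_attained _ _ ka) (fmax_attained _ _ kb) !hc.
have := PL_oscillation _ a b hP; lra.
Qed.

Lemma Sfun_continuous E : continuous (fun D => Sfun (mult D \- mult E)).
Proof.
pose L := \sum_(e : edge G) elen e.
have L0 : 0 <= L by apply: sumr_ge0 => e _; rewrite ltW ?elen_gt0.
apply/continuousP => A oA; rewrite -[open _]/(rho_open _) => D /= AD.
have /nbhs_ballP[eps /= e0 eA] := open_nbhs_nbhs (conj oA AD).
(* [L] is a Lipschitz constant; it is 0 for a graph without edges, hence the [+ 1]. *)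
exists (eps / (L + 1)); first by rewrite divr_gt0// ltr_wpDl.
move=> D' /= DD'; apply: eA; rewrite /ball /=.
have dE : rho D D' * L < eps.
  apply: (@le_lt_trans _ _ (rho D D' * (L + 1))); last first.
    by rewrite -ltr_pdivlMr// ltr_wpDl.
  have [v _] : exists v, v \in vertex G by apply/card_gt0P; exact: vertex_gt0.
  have [hP _] := potentialP D D'.
  (* Comparing a point with itself gives [0 <= rho D D']. *)
  have := PL_oscillation _ (inl v) (inl v) hP; rewrite subrr -/(rho D D').
  by move=> r0; rewrite ler_wpM2l// lerDl.
have := Sfun_dist D D' E; have := Sfun_dist D' D E.
have : rho D' D * L <= rho D D' * L by rewrite ler_wpM2r// rho_sym_le.
rewrite -/L ltr_norml; lra.
Qed.

(** With [F1 + g = F2 + m], the point to take is the one where the path truncates [g] at height [m].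
    The zeros of [F2] and [F1] give [0 <= m] and [m <= rho D1 D2], so this height does occur on the
    path. *)
Lemma tconv_min D1 D2 E (T : set (effdiv G d)) (F1 F2 : gpoint G -> R) :
  tropically_convex T -> T D1 -> T D2 ->
  PL F1 -> laplacian F1 = mult D1 \- mult E -> normalized F1 ->
  PL F2 -> laplacian F2 = mult D2 \- mult E -> normalized F2 ->
  exists2 D, T D &
    Sfun (mult D \- mult E) = gintegral (fun p => Num.min (F1 p) (F2 p)).
Proof.
move=> cT TD1 TD2 F1P F1l [F10 [p F1p]] F2P F2l [F20 [q F2q]].
have [hP hl] := potentialP D1 D2; set h := potential _ in hP hl.
have [gn [z gz]] := normalize _ hP.
pose g r := h r - fmin h; have gP : PL g by exact: PL_addcst.
have gl : laplacian g = mult D2 \- mult D1 by rewrite laplacian_addcst.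
have [|m mE] := laplacian_inj _ _ (PLD _ _ F1P gP) F2P.
  by rewrite laplacianD// F1l gl F2l; apply/funext => r /=; ring.
have m0 : 0 <= m.
  by have := mE q; rewrite F2q; have := F10 q; have := gn q; rewrite -/(g q); lra.
have mrho : m <= rho D1 D2.
  have := PL_oscillation _ p z hP; rewrite -/(rho D1 D2).
  have := mE p; have := F20 p; move: gz; rewrite F1p /g; lra.
have [t t01 tE] : exists2 t, 0 <= t <= 1 & t * rho D1 D2 = m.
  (* If the distance is 0 then [m = 0] and [t = 0] works; otherwise [t = m / rho D1 D2]. *)
  have [r0|r0] := eqVneq (rho D1 D2) 0.
    by exists 0; [rewrite lexx ler01|rewrite mul0r; apply: le_anti; rewrite m0 -r0 mrho].
  have r_gt0 : 0 < rho D1 D2 by rewrite lt_neqAle eq_sym r0 (le_trans m0).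
  exists (m / rho D1 D2); last by rewrite divfK.
  by rewrite divr_ge0 ?(ltW r_gt0)//= ler_pdivrMr// mul1r.
have [|D TD DE] := cT D1 D2 TD1 TD2 (tpath D1 D2 t).
  by exists t => //=; rewrite in_itv.
exists D => //.
have cP : PL (fun r => Num.min m (g r)) by apply: PL_min => //; exact: PL_cst.
apply: Sfun_normalized; first exact: PL_min.
  have -> : (fun r => Num.min (F1 r) (F2 r)) =
      (fun r => (F1 r + Num.min m (g r)) + (- m)).
    by apply/funext => r; rewrite addr_minr addr_minl addrK mE addrK.
  rewrite laplacian_addcst; last exact: PLD.
  rewrite laplacianD// F1l DE /tpath tE -/h.
  by apply/funext => r /=; rewrite /g; ring.
split=> [r|]; first by rewrite le_min F10 F20.
(* The minimum vanishes where [F1] does, as [F2] is nonnegative. *)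
by exists p; rewrite F1p; apply/min_idPl.
Qed.

End Degree.
End Minimizer.

(** * Existence and uniqueness of the minimizer *)

Lemma mult_inj (R : realType) (G : metric_graph R) (d : R) :
  injective (@mult R G d).
Proof.
move=> [m1 a1 b1 c1] [m2 a2 b2 c2] /= E; subst m2.
by congr EffDiv; exact: Prop_irrelevance.
Qed.

Theorem theorem5p3 (R : realType) (G : metric_graph R) (d : R) (hd : 0 <= d)
    (T : set (effdiv G d)) (T_nonempty : T !=set0)
    (T_convex : tropically_convex T) (T_compact : compact T)
    (E : effdiv G d) :
  exists! TE : effdiv G d,
    T TE /\ forall D : effdiv G d, T D ->
      Sfun (mult TE \- mult E) <= Sfun (mult D \- mult E).
Proof.
have [|D1 /set_mem TD1 min1] := compact_EVT_min T_nonempty T_compact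
  (f := fun D => Sfun (mult D \- mult E)).
  exact/continuous_subspaceT/Sfun_continuous.
have {}min1 D : T D -> Sfun (mult D1 \- mult E) <= Sfun (mult D \- mult E).
  by move=> TD; apply: min1; exact: mem_set.
exists D1; split => // D2 [TD2 min2]; apply: mult_inj.
have [F1 [F1P F1l F1n]] := normalized_potential D1 E.
have [F2 [F2P F2l F2n]] := normalized_potential D2 E.
pose F p := Num.min (F1 p) (F2 p); have FP : PL F by exact: PL_min.
have [D TD DE] := tconv_min _ _ _ _ _ _
  T_convex TD1 TD2 F1P F1l F1n F2P F2l F2n.
have FF1 p : F p <= F1 p by rewrite ge_min lexx.
have FF2 p : F p <= F2 p by rewrite ge_min lexx orbT.
(* Applied to both minimizers: [F' - F] is nonnegative, and its integral is at most 0 since [D] does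
   no better than [D']. *)
have Feq (D' : effdiv G d) F' : PL F' -> (forall p, F p <= F' p) ->
    Sfun (mult D' \- mult E) = gintegral F' ->
    Sfun (mult D' \- mult E) <= Sfun (mult D \- mult E) ->
    forall e x, 0 <= x <= elen e -> F' (epoint e x) = F (epoint e x).
  move=> F'P FF' D'E D'D e x xl; apply/eqP; rewrite -subr_eq0; apply/eqP.
  apply: (gintegral_le0 _ (PLB _ _ F'P FP)) => // [p|]; first by rewrite subr_ge0.
  by rewrite gintegralB// -D'E /F -DE subr_le0.
have FE1 := Feq D1 F1 F1P FF1 (Sfun_normalized _ _ _ F1P F1l F1n) (min1 _ TD).
have FE2 := Feq D2 F2 F2P FF2 (Sfun_normalized _ _ _ F2P F2l F2n) (min2 _ TD).
(* [F1] and [F2] are known to agree only along the edges, which suffices for their Laplacians;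
   cancelling [E] then identifies the divisors. *)
have : laplacian F1 = laplacian F2.
  by apply: eq_laplacian => // e x xl; rewrite FE1 ?FE2.
rewrite F1l F2l => E12; apply/funext => p.
by have := congr1 (fun h => h p) E12; rewrite /= => /addIr.
Qed.
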